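(* Let $\kappa\in\mathbb N$, let $\mathfrak p$ satisfy the kernel assumptions (K1)--(K6) of the context, let $G\in C_c^{1,\infty}(\mathbb R_+\times\mathbb R)$ and let $T>0$ be such that the support of $G$ is contained in $[0,T)\times\mathbb R$. Let $H_t(u,v)=\mathfrak p(u,v)[G_t(v)-G_t(u)]$ and $H^N_{t,x,y}=H_t(\frac xN,\frac yN)$. Let $(\mathbb P_N)_{N\ge1}$ be probability measures on $\mathbb D(\mathbb R_+;\mathbb N_0^{\mathbb Z})$, with expectations $\mathbb E_N$, such that for every $T'>0$ $$\limsup_{N\to\infty}\ \sup_{x\in\mathbb Z}\ \mathbb E_N\Big[\int_0^{T'}|\eta_t(x)|^2\,dt\Big]<\infty .$$ Then for any $R>0$ and $\epsilon'>0$, $$\limsup_{\epsilon\downarrow0}\limsup_{N\to\infty}\mathbb E_N\Bigg[\frac1{N^2}\int_0^T\Bigg|\sum_{(x,y)\in NA_{R,\epsilon'}}H^N_{t,x,y}\Big(\eta_t(x)\big(\kappa-\eta_t(y)\big)-\eta_t(x)^{\epsilon N}\big(\kappa-\eta_t(y)^{\epsilon N}\big)\Big)\Bigg|\,dt\Bigg]=0 .$$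
   Context: $\mathbb N=\{1,2,\dots\}$, $\mathbb N_0=\mathbb N\cup\{0\}$, $\mathbb R_+=[0,\infty)$, $\mathbb R_0^2=\{(u,v)\in\mathbb R^2:u\ne v\}$. $\mathbb D(\mathbb R_+;E)$: càdlàg paths with the Skorokhod topology; $(\eta_t)_{t\ge 0}$ is the canonical process. $C_c^{1,\infty}(\mathbb R_+\times\mathbb R)$: continuous functions compactly supported in space and time, continuously differentiable in time and smooth in space; $G_t=G(t,\cdot)$. Kernel assumptions. $\mathfrak p:\mathbb R_0^2\to[0,\infty)$, with the convention $\mathfrak p(u,u)=0$, and $\mathfrak s(u,v):=\tfrac12(\mathfrak p(u,v)+\mathfrak p(v,u))$. (K1) $\mathfrak p$ is Lipschitz continuous on every compact subset of $\mathbb R_0^2$. (K2) There is $\gamma>0$ with $\mathfrak p(\lambda u,\lambda v)=\lambda^{-(1+\gamma)}\mathfrak p(u,v)$ for all $(u,v)\in\mathbb R^2_0$, $\lambda>0$. (K3) For every compact $K\subset\mathbb R$, $\int_K\int_{\mathbb R}\mathfrak s(u,v)\min\{|u-v|,1\}\,dv\,du<\infty$. (K4) $\sup_{x\in\mathbb Z}\sum_{y\in\mathbb Z,\,y\ne x}\mathfrak s(x,y)<\infty$. (K5) For every $R>0$, $\limsup_{\epsilon\downarrow0}\limsup_{N\to\infty}\frac{N^\gamma}{N^2}\sum_{|x|<RN}\sum_{|y-x|\le\epsilon N}\mathfrak s(x,y)|x-y|=0$. (K6) For every $R>0$, $\limsup_{m\to\infty}\limsup_{N\to\infty}\frac{N^\gamma}{N}\sum_{|x|<RN}\sum_{|y|\ge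 mN}\mathfrak s(x,y)=0$. (Sums over integers $x,y$.) Sets and averages. $A_R=\mathbb R^2\setminus\{(u,v):|u|\ge R\text{ and }|v|\ge R\}$, $A_{R,\epsilon'}=\{(u,v)\in A_R:\epsilon'<|u-v|<(\epsilon')^{-1}\}$; sums over $(x,y)\in NA$ mean sums over $(x,y)\in\mathbb Z^2$ with $(x/N,y/N)\in A$. Block average: $\eta(x)^{\ell}=\frac1{2\ell+1}\sum_{z\in\mathbb Z,|z|\le\ell}\eta(x+z)$, and $\eta(x)^{\epsilon N}$ means $\ell=\lfloor\epsilon N\rfloor$. *)

(* Defs.v *)
From HB Require Import structures.
From mathcomp Require Import all_boot all_order all_algebra.
From mathcomp Require Import all_classical all_reals all_analysis.

Set Implicit Arguments.
Unset Strict Implicit.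
Unset Printing Implicit Defensive.

Import Order.TTheory GRing.Theory Num.Theory.
Import numFieldNormedType.Exports.

Local Open Scope classical_set_scope.
Local Open Scope ring_scope.

(* Paths on [0, oo[ are represented by functions on the whole of R that are
   constant on ]-oo, 0]; this normalization makes the representation unique. *)
Record cadlag_path (R : realType) (E : puniformType) := CadlagPath {
  cadlag_fun :> R -> E ;
  cadlag_right : forall t, 0 <= t -> cadlag_fun s @[s --> t^'+] --> cadlag_fun t ;
  cadlag_left : forall t, 0 < t -> cvg (cadlag_fun s @[s --> t^'-]) ;
  cadlag_neg : forall t, t < 0 -> cadlag_fun t = cadlag_fun 0 }.

Section skorokhod.
Variables (R : realType) (E : puniformType).
Local Notation D := (cadlag_path R E).

HB.instance Definition _ := gen_eqMixin D.
HB.instance Definition _ := gen_choiceMixin D.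

Lemma cst_cadlag_right (e : E) (t : R) :
  0 <= t -> (fun=> e) s @[s --> t^'+] --> (fun=> e) t.
Proof. by move=> _; exact: cvg_cst. Qed.

Lemma cst_cadlag_left (e : E) (t : R) :
  0 < t -> cvg ((fun=> e) s @[s --> t^'-]).
Proof. by move=> _; exact: is_cvg_cst. Qed.

Definition cst_cadlag (e : E) : D :=
  CadlagPath (@cst_cadlag_right e) (@cst_cadlag_left e) (fun _ _ => erefl).

HB.instance Definition _ := isPointed.Build D (cst_cadlag point).

(* The increasing bijections of [0, oo[ (automatically continuous). *)
Definition time_change : set (R -> R) :=
  [set l | set_bij `[0, +oo[ `[0, +oo[ l /\
           {in `[0, +oo[ &, {mono l : s t / s < t}}].

(* g_n --> f for the Skorokhod J1 topology iff, for all T, e and V, g_n is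
   eventually in skorokhod_ball f T e V (Ethier & Kurtz, Markov Processes,
   Proposition 3.5.3 (c)); as that topology is metrizable, these sets generate
   the filter of neighbourhoods of f. *)
Definition skorokhod_ball (f : D) (T e : R) (V : set (E * E)) : set D :=
  [set g | exists2 l : R -> R, time_change l &
     forall s, 0 <= s <= T -> `|l s - s| < e /\ V (f (l s), g s)].

Definition skorokhod_open (U : set D) : Prop :=
  forall f, U f -> exists T e V,
    [/\ 0 < T, 0 < e, entourage V & skorokhod_ball f T e V `<=` U].

Lemma sub_skorokhod_ball (f : D) (T T' e e' : R) (V V' : set (E * E)) :
  T <= T' -> e' <= e -> V' `<=` V ->
  skorokhod_ball f T' e' V' `<=` skorokhod_ball f T e V.
Proof.
move=> TT' ee' VV' g [l lt lP]; exists l => // s /andP[s0 sT].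
have [|h1 h2] := lP s; first by rewrite s0 (le_trans sT).
by split; [exact: lt_le_trans ee'|exact: VV'].
Qed.

Lemma skorokhod_openT : skorokhod_open setT.
Proof. by move=> f _; exists 1, 1, setT; split=> //; exact: filterT. Qed.

Lemma skorokhod_openI : setI_closed skorokhod_open.
Proof.
move=> A B oA oB f [/oA[T [e [V [T0 e0 eV sA]]]] /oB[T' [e' [V' [_ e0' eV' sB]]]]].
exists (Num.max T T'), (Num.min e e'), (V `&` V'); split.
- by rewrite lt_max T0.
- by rewrite lt_min e0 e0'.
- exact: filterI.
- move=> g gP; split; [apply: sA|apply: sB]; apply: sub_skorokhod_ball gP.
  + by rewrite le_max lexx.
  + by rewrite ge_min lexx.
  + exact: subIsetl.
  + by rewrite le_max lexx orbT.
  + by rewrite ge_min lexx orbT.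
  + exact: subIsetr.
Qed.

Lemma skorokhod_open_bigU (I : Type) (F : I -> set D) :
  (forall i, skorokhod_open (F i)) -> skorokhod_open (\bigcup_i F i).
Proof.
move=> oF f [i _ /oF[T [e [V [T0 e0 eV sF]]]]].
by exists T, e, V; split=> // g /sF Fg; exists i.
Qed.

HB.instance Definition _ := isOpenTopological.Build D
  skorokhod_openT skorokhod_openI skorokhod_open_bigU.

End skorokhod.

(* N_0^Z with the product of the discrete topologies. *)
Definition configuration : Type := prod_topology (fun _ : int => nat).

HB.instance Definition _ := Uniform.on configuration.
HB.instance Definition _ := isPointed.Build configuration (fun=> 0%N).

(* D(R_+; N_0^Z) with the Borel sigma-algebra of the Skorokhod topology. *)
Definition path_space (R : realType) :=
  g_sigma_algebraType (@open (cadlag_path R configuration)).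

Section kernel.
Variable R : realType.
Local Notation mu := (@lebesgue_measure R).

Definition sym_kernel (p : R -> R -> R) (u v : R) : R :=
  2^-1 * (p u v + p v u).

Local Open Scope ereal_scope.

Record kernel_assumptions (gamma : R) (p : R -> R -> R) : Prop := {
  kernel_ge0 : forall u v, u != v -> (0 <= p u v)%R ;
  kernel_diag : forall u, p u u = 0%R ;
  kernel_K1 : forall K : set (R * R), compact K ->
    K `<=` [set z | z.1 != z.2] ->
    [lipschitz (p z.1 z.2 : R^o) | z in K] ;
  kernel_gamma : (0 < gamma)%R ;
  kernel_K2 : forall u v lambda, u != v -> (0 < lambda)%R ->
    p (lambda * u)%R (lambda * v)%R = (lambda `^ (- (1 + gamma)) * p u v)%R ;
  kernel_K3 : forall K : set R, compact K ->
    \int[mu]_(u in K) \int[mu]_v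
      (sym_kernel p u v * Num.min `|u - v| 1)%:E < +oo ;
  kernel_K4 :
    ereal_sup [set \esum_(y in [set y : int | y != x])
                     (sym_kernel p x%:~R y%:~R)%:E | x in @setT int] < +oo ;
  kernel_K5 : forall r : R, (0 < r)%R ->
    limf_esup (fun e : R => limn_esup (fun N : nat =>
      (N%:R `^ gamma / N%:R ^+ 2)%:E *
      \esum_(x in [set x : int | (`|x%:~R| < r * N%:R)%R])
      \esum_(y in [set y : int | (`|(y - x)%:~R| <= e * N%:R)%R])
        (sym_kernel p x%:~R y%:~R * `|(x - y)%:~R|)%:E)) 0^'+ = 0%E ;
  kernel_K6 : forall r : R, (0 < r)%R ->
    limn_esup (fun m : nat => limn_esup (fun N : nat =>
      (N%:R `^ gamma / N%:R)%:E *
      \esum_(x in [set x : int | (`|x%:~R| < r * N%:R)%R])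
      \esum_(y in [set y : int | ((m%:R : R) * N%:R <= `|y%:~R|)%R])
        (sym_kernel p x%:~R y%:~R)%:E)) = 0%E }.

End kernel.

Section test_function.
Variable R : realType.

(* Only the values G t u with 0 <= t matter. *)
Definition supp (G : R -> R -> R) : set (R * R) :=
  closure [set z | 0 <= z.1 /\ G z.1 z.2 != 0].

(* The time derivative at 0 is one-sided. *)
Record test_function (G : R -> R -> R) : Prop := {
  test_continuous :
    {within [set z : R * R | 0 <= z.1], continuous (fun z => G z.1 z.2)} ;
  test_compact : compact (supp G) ;
  test_C1_time : forall u, exists2 dG : R -> R,
    {within `[0, +oo[, continuous dG} &
    forall t, 0 <= t ->
      (G s u - G t u) / (s - t) @[s --> within [set s | 0 <= s] t^']
        --> dG t ;
  test_smooth_space : forall t n u, 0 <= t ->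
    derivable (derive1n n (G t)) u 1 }.

End test_function.

Section averages.
Variable R : realType.

Definition A_ (r : R) : set (R * R) :=
  ~` [set z | r <= `|z.1| /\ r <= `|z.2|].

Definition A_eps (r e : R) : set (R * R) :=
  A_ r `&` [set z | e < `|z.1 - z.2| < e^-1].

Definition scaled (N : nat) (A : set (R * R)) : set (int * int) :=
  [set z | A (z.1%:~R / N%:R, z.2%:~R / N%:R)].

Definition block_avg (l : nat) (eta : configuration) (x : int) : R :=
  (2 * l + 1)%:R^-1 *
  \sum_(z \in [set z : int | `|z| <= l%:Z]) ((eta (x + z))%:R : R).

Definition H_ (p G : R -> R -> R) (t u v : R) : R := p u v * (G t v - G t u).

End averages.

(* Main.v *)
(** Write [phi (x, y) = eta x (kappa - eta y)] and let [F] be the function [H_t]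
    cut off outside [A_eps r eps'].  The product of the two block averages is
    the average of [phi (w + k)] over the shifts [k] of size at most [eps N], so
    moving these shifts from [phi] onto [F] turns the sum into an average of the
    sums of [(F w - F (w - k)) phi w].  The increments of [F] are small,
    uniformly in time, when [w] and [w - k] both lie in the set, because [H_t]
    is uniformly continuous there; otherwise they are bounded and [w] lies in
    the boundary layer of the set, which is covered by strips of width
    [O(eps N)] around finitely many lines.  As [|phi (x, y)|] is at most
    [(kappa + 1) (eta x ^ 2 + eta y ^ 2)], the second moment bound yields an
    estimate [O(omega + eps)] for every prescribed bound [omega] on the small
    increments.

    Exchanging the expectation with finite sums requires the measurability of
    [eta |-> int_0^T (eta_t x) ^ 2 dt]: "the path visits the open set [U] during
    a given open time window" is a Skorokhod-open event, which makes evaluations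
    measurable; right-continuity then makes them jointly measurable in the path
    and the time. *)

Require Import Defs.
From HB Require Import structures.
From mathcomp Require Import all_boot all_order all_algebra.
From mathcomp Require Import all_classical all_reals all_analysis.
From mathcomp Require Import measurable_realfun.
From mathcomp Require Import ring lra zify.

Set Implicit Arguments.
Unset Strict Implicit.
Unset Printing Implicit Defensive.

Import Order.TTheory GRing.Theory Num.Theory.
Import numFieldNormedType.Exports.

Local Open Scope classical_set_scope.
Local Open Scope ring_scope.

(** * Measurability of the occupation variables *)

Section path_evaluation.
Variables (R : realType) (E : puniformType).
Local Notation D := (cadlag_path R E).
Local Notation paths := (g_sigma_algebraType (@open D)).
Implicit Types (f : D) (U : set E) (t : R).

Lemma cadlag_right_continuous f : right_continuous f.
Proof.
move=> t; have [t0|t0] := leP 0 t; first exact: cadlag_right.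
rewrite (cadlag_neg f t0); apply: cvg_near_cst.
by apply: filterS (nbhs_right_lt t0) => s; exact: cadlag_neg.
Qed.

Lemma time_change_preimage (l : R -> R) (s e : R) :
  time_change l -> 0 <= s -> 0 < e ->
  (forall u, 0 <= u <= s + e -> `|l u - u| < e) ->
  exists2 s', 0 <= s' <= s + e & l s' = s.
Proof.
move=> [[_ _ l_surj] l_mono] s0 e0 le.
have [|s' /= + ls'] := l_surj s; first by rewrite /= in_itv/= s0.
rewrite in_itv/= andbT => s'0; exists s' => //; rewrite s'0 leNgt /=.
apply/negP => se_lt; have se0 : 0 <= s + e by lra.
have := l_mono (s + e) s'; rewrite !in_itv/= !andbT => /(_ se0 s'0).
rewrite se_lt ls'; have := le (s + e); rewrite se0 lexx => /(_ isT).
by rewrite ltr_distl => /andP[]; lra.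
Qed.

(* A time change moves times by less than any prescribed amount, so a value
   taken strictly inside a time window is nearly taken there by close paths. *)
Lemma open_hitting_event (a b : R) U : 0 <= a -> open U ->
  open [set f : D | exists2 s, a < s < b & U (f s)].
Proof.
move=> a0 oU; rewrite -[open _]/(skorokhod_open _) => f [s /andP[as_ sb] Ufs].
have := open_nbhs_nbhs (conj oU Ufs); rewrite -nbhs_entourageE => -[V eV VU].
pose e := Num.min (s - a) (b - s).
have e0 : 0 < e by rewrite lt_min !subr_gt0 as_.
have [ea eb] : e <= s - a /\ e <= b - s by rewrite /e !ge_min !lexx orbT.
exists (s + e), e, V; split=> //; first by lra.
move=> g [l l_change lP].
have s0 : 0 <= s by lra.
have l_close u : 0 <= u <= s + e -> `|l u - u| < e by move=> /lP[].
have [s' s'P ls'] := time_change_preimage l_change s0 e0 l_close.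
have [] := lP _ s'P; rewrite ls' ltr_distl => /andP[? ?] Vg.
by exists s'; [apply/andP; split; lra|apply: VU; exact/mem_set].
Qed.

Lemma clopen_evaluationP f t U : clopen U ->
  U (f t) <-> forall k : nat, exists2 s, t < s < t + k.+1%:R^-1 & U (f s).
Proof.
move=> [oU cU]; split=> [Uft k|Uf].
  have /filter_ex[s [ts Ufs]] : \forall s \near t^'+,
      t < s < t + k.+1%:R^-1 /\ U (f s); last by exists s.
  near=> s; split; last first.
    by near: s; exact/cadlag_right_continuous/open_nbhs_nbhs.
  apply/andP; split; near: s; first exact: nbhs_right_gt.
  by apply: nbhs_right_lt; rewrite ltrDl.
apply: contrapT => nUft; have nbhsCU : nbhs (f t) (~` U).
  by apply: open_nbhs_nbhs; split=> //; exact: closed_openC.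
have [d /= d0 dP] := cadlag_right_continuous nbhsCU.
have [k _ /(_ _ (leqnn k)) kd] := near_infty_natSinv_lt (PosNum d0).
have [s /andP[ts st]] := Uf k; apply: dP => //=.
by rewrite ltr_distlC (lt_trans _ ts) ?gtrBl// (lt_trans st)// ltrD2l.
Unshelve. all: by end_near. Qed.

Lemma measurable_evaluation_clopen t U : clopen U ->
  measurable [set f : paths | U (f t)].
Proof.
move=> clopenU; wlog t0 : t / 0 <= t.
  move=> nonneg; have [|t0] := leP 0 t; first exact: nonneg.
  rewrite [X in measurable X](_ : _ = [set f : paths | U (f 0)]).
    exact: nonneg.
  by apply/seteqP; split=> f /=; rewrite (cadlag_neg f t0).
rewrite [X in measurable X](_ : _ = \bigcap_k [set f : paths |
    exists2 s, t < s < t + k.+1%:R^-1 & U (f s)]); last first.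
  apply/seteqP; split=> f /= Uf.
    by move=> k _; exact: (clopen_evaluationP f t clopenU).1 Uf k.
  by apply: (clopen_evaluationP f t clopenU).2 => k; exact: Uf.
apply: bigcapT_measurable => k; apply: sub_sigma_algebra.
by apply: open_hitting_event => //; case: clopenU.
Qed.

End path_evaluation.

Section right_continuous_process.
Context d (Omega : measurableType d) (R : realType).

Let next_grid_point (k : nat) (t : R) : R :=
  (Num.floor (k.+1%:R * t) + 1)%:~R / k.+1%:R.

Let next_grid_point_cvg (t : R) : next_grid_point ^~ t @ \oo --> t^'+.
Proof.
move=> A [e /= e0 eA].
apply: filterS (near_infty_natSinv_lt (PosNum e0)) => k /= ke.
have k0 : (0 : R) < k.+1%:R by [].
have /andP[fle ltf] := floor_itv (k.+1%:R * t).
have t_lt : t < next_grid_point k t by rewrite ltr_pdivlMr// mulrC.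
have le_t : next_grid_point k t <= t + k.+1%:R^-1.
  by rewrite ler_pdivrMr// mulrDl mulVf// [t * _]mulrC intrD1 lerD2r.
apply: eA => //=; rewrite ltr_distlC (lt_trans _ t_lt) ?gtrBl//=.
by rewrite (le_lt_trans le_t)// ltrD2l.
Qed.

Lemma measurable_right_continuous_process (X : Omega -> R -> R) :
  (forall t, measurable_fun setT (X^~ t)) ->
  (forall w, right_continuous (X w)) ->
  measurable_fun setT (fun z : Omega * R => X z.1 z.2).
Proof.
move=> mX rcX; apply: (measurable_fun_cvg
    (h := fun k z => X z.1 (next_grid_point k z.2))); last first.
  move=> [w t] _.
  exact: (cvg_comp _ (X w) (@next_grid_point_cvg t) (rcX w t)).
move=> k _ B mB; rewrite setTI.
pose grid_cell (j : int) : set R := [set t | Num.floor (k.+1%:R * t) = j].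
rewrite (_ : _ @^-1` B = \bigcup_(j : int)
    ((X^~ ((j + 1)%:~R / k.+1%:R) @^-1` B) `*` grid_cell j)); last first.
  apply/seteqP; split=> [[w t] /= Bw|[w t] [j _ [/= Bw fj]]].
    by exists (Num.floor (k.+1%:R * t)).
  by rewrite /next_grid_point fj.
apply: countable_bigcupT_measurable => // j; apply: measurableX.
  by rewrite -[X in measurable X]setTI; exact: mX.
rewrite (_ : grid_cell j = `[j%:~R / k.+1%:R, (j + 1)%:~R / k.+1%:R[%classic).
  exact: measurable_itv.
apply/seteqP; split=> t; rewrite /grid_cell/= in_itv/= ler_pdivrMr//;
  rewrite ltr_pdivlMr//.
  by move=> <-; rewrite ![t * _]mulrC floor_itv.
by rewrite ![t * _]mulrC -floor_eq => /eqP.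
Qed.

End right_continuous_process.

Section occupation_variables.
Variable R : realType.
Implicit Types x : int.

Lemma clopen_coordinate x (A : set nat) :
  clopen [set e : configuration | A (e x)].
Proof.
have coord_cont : continuous (fun e : configuration => e x).
  exact: (@proj_continuous int (fun=> nat) x).
split; first by apply: open_comp (discrete_open A) => e _; exact: coord_cont.
by apply: preimage_closed (discrete_closed A) => e _; exact: coord_cont.
Qed.

Lemma measurable_occupation x :
  measurable_fun setT (fun z : path_space R * R => (z.1 z.2 x)%:R : R).
Proof.
apply: (measurable_right_continuous_process
    (X := fun (f : path_space R) t => (f t x)%:R)) => [t _ B mB|f t].
  rewrite setTI; apply: (@measurable_evaluation_clopen R configuration t
    [set e | B (e x)%:R]).
  exact: (clopen_coordinate x [set n | B n%:R]).
apply: cvg_near_cst.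
have [eq_open _] := clopen_coordinate x [set n | n%:R = (f t x)%:R :> R].
exact: (cadlag_right_continuous (open_nbhs_nbhs (conj eq_open erefl))).
Qed.

Definition sqr_occupation x (z : path_space R * R) : \bar R :=
  (((z.1 z.2 x)%:R : R) ^+ 2)%:E.

Lemma sqr_occupation_ge0 x z : (0 <= sqr_occupation x z)%E.
Proof. by rewrite lee_fin sqr_ge0. Qed.

Lemma measurable_sqr_occupation x : measurable_fun setT (sqr_occupation x).
Proof.
by apply/measurable_EFinP; apply: measurable_funX; exact: measurable_occupation.
Qed.

End occupation_variables.

(** * Integrals, limits superior and uniform continuity *)

Section integrals.
Local Open Scope ereal_scope.

Lemma measurable_fun_integral_section d1 d2 (T1 : measurableType d1)
    (T2 : measurableType d2) (R : realType)
    (mu : {sigma_finite_measure set T2 -> \bar R}) (D : set T2)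
    (g : T1 * T2 -> \bar R) :
  measurable D -> measurable_fun setT g -> (forall z, 0 <= g z) ->
  measurable_fun setT (fun x => \int[mu]_(y in D) g (x, y)).
Proof.
move=> mD mg g0; pose gD (z : T1 * T2) := g z * (\1_D z.2)%:E.
rewrite [X in measurable_fun _ X](_ : _ = fubini_F mu gD); last first.
  apply/funext => x; rewrite /fubini_F [LHS]integral_mkcond.
  apply: eq_integral => y _; rewrite patchE /gD indicE.
  by case: ifPn; rewrite ?mule1 ?mule0.
apply: measurable_fun_fubini_tonelli_F => [|z]; last first.
  by rewrite mule_ge0// lee_fin.
apply: emeasurable_funM => //; apply/measurable_EFinP.
exact: (measurableT_comp (measurable_indic mD) measurable_snd).
Qed.

Section monotonicity.
Context d (T : measurableType d) (R : realType).
Variables (mu : {measure set T -> \bar R}) (D : set T).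

(* The integral of a nonnegative function is a supremum over the simple
   functions below it, hence monotone without any measurability. *)
Lemma ge0_le_integral_nonmeasurable (f g : T -> \bar R) :
  (forall x, D x -> 0 <= f x) -> (forall x, D x -> f x <= g x) ->
  \int[mu]_(x in D) f x <= \int[mu]_(x in D) g x.
Proof.
move=> f0 fg; have g0 x : D x -> 0 <= g x.
  by move=> Dx; exact: le_trans (f0 x Dx) (fg x Dx).
rewrite !ge0_integralE//; apply: ge_ereal_sup => _ [h hf <-].
apply: ereal_sup_ubound; exists h => // x; apply: (le_trans (hf x)).
by rewrite !patchE; case: ifPn => // /set_mem/fg.
Qed.

Lemma ge0_le_integral_sum (I : Type) (s : seq I) (a : I -> R)
    (f : T -> \bar R) (g : I -> T -> \bar R) :
  measurable D -> (forall i, measurable_fun D (g i)) ->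
  (forall i, (0 <= a i)%R) -> (forall i x, D x -> 0 <= g i x) ->
  (forall x, D x -> 0 <= f x) ->
  (forall x, D x -> f x <= \sum_(i <- s) (a i)%:E * g i x) ->
  \int[mu]_(x in D) f x <= \sum_(i <- s) (a i)%:E * \int[mu]_(x in D) g i x.
Proof.
move=> mD mg a0 g0 f0 f_le.
apply: (le_trans (ge0_le_integral_nonmeasurable f0 f_le)).
rewrite ge0_integral_sum//.
- by apply: lee_sum => i _; rewrite ge0_integralZl ?lee_fin//; exact: g0.
- by move=> i; exact: measurable_funeM.
- by move=> i x Dx; rewrite mule_ge0 ?lee_fin// g0.
Qed.

End monotonicity.

Lemma ge0_le_iterated_integral_sum d1 d2 (T1 : measurableType d1)
    (T2 : measurableType d2) (R : realType) (mu1 : {measure set T1 -> \bar R})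
    (mu2 : {sigma_finite_measure set T2 -> \bar R}) (D : set T2) (I : Type)
    (s : seq I) (q : R) (a : I -> R) (f : T1 -> T2 -> \bar R)
    (g : I -> T1 * T2 -> \bar R) :
  measurable D -> (forall i, measurable_fun setT (g i)) ->
  (0 <= q)%R -> (forall i, (0 <= a i)%R) -> (forall i z, 0 <= g i z) ->
  (forall x y, D y -> 0 <= f x y) ->
  (forall x y, D y -> f x y <= \sum_(i <- s) (a i)%:E * g i (x, y)) ->
  \int[mu1]_x (q%:E * \int[mu2]_(y in D) f x y) <=
  \sum_(i <- s) (q * a i)%:E * \int[mu1]_x \int[mu2]_(y in D) g i (x, y).
Proof.
move=> mD mg q0 a0 g0 f0 f_le; apply: ge0_le_integral_sum => //.
- by move=> i; exact: measurable_fun_integral_section.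
- by move=> i; exact: mulr_ge0.
- by move=> i x _; exact: integral_ge0.
- by move=> x _; rewrite mule_ge0 ?lee_fin// integral_ge0// => y; exact: f0.
move=> x _; under eq_bigr do rewrite EFinM -muleA.
rewrite -ge0_sume_distrr; last first.
  by move=> i _; rewrite mule_ge0 ?lee_fin// integral_ge0.
rewrite lee_wpmul2l ?lee_fin//; apply: ge0_le_integral_sum => //.
- by move=> i; apply: measurable_funTS; exact: measurable_fun_pair2.
- by move=> y; exact: f0.
- by move=> y; exact: f_le.
Qed.

End integrals.

Section limf_esup.
Context (T : choiceType) (X : filteredType T) (R : realType).
Implicit Types (u : X -> \bar R) (F : set_system X).
Local Open Scope ereal_scope.

Lemma limf_esup_le u F (c : \bar R) :
  (\forall x \near F, u x <= c) -> limf_esup u F <= c.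
Proof.
move=> uc; apply: (@le_trans _ _ (ereal_sup (u @` [set x | u x <= c]))).
  by apply: ereal_inf_lbound; exists [set x | u x <= c].
by apply: ge_ereal_sup => _ [x ? <-].
Qed.

Lemma limf_esup_eq0 u F : ProperFilter F -> (forall x, 0 <= u x) ->
  (forall e : R, (0 < e)%R -> \forall x \near F, u x <= e%:E) ->
  limf_esup u F = 0.
Proof.
move=> PF u0 u_small; apply/eqP; rewrite eq_le; apply/andP; split.
  by apply/lee_addgt0Pr => e e0; rewrite add0e; exact/limf_esup_le/u_small.
by apply: limf_esup_ge0 => //; exact: filter_not_empty.
Qed.

Lemma limf_esup_lty_bounded u F : Filter F -> limf_esup u F < +oo ->
  exists2 C : R, (0 <= C)%R & \forall x \near F, u x <= C%:E.
Proof.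
move=> FF /ereal_inf_lt[_ [V FV <-] supV].
exists (fine (maxe 0 (ereal_sup (u @` V)))).
  by rewrite fine_ge0// le_max lexx.
apply: filterS FV => x Vx; rewrite fineK.
  by rewrite le_max; apply/orP; right; apply: ereal_sup_ubound; exists x.
by rewrite ge0_fin_numE ?le_max ?lexx// gt_max supV ltry.
Qed.

Lemma limf_esup_sup_lty_bounded (I : Type) (g : X -> I -> \bar R) F :
  Filter F -> limf_esup (fun x => ereal_sup (range (g x))) F < +oo ->
  exists2 C : R, (0 <= C)%R & \forall x \near F, forall i, g x i <= C%:E.
Proof.
move=> FF /(limf_esup_lty_bounded FF)[C C0 supC]; exists C => //.
apply: filterS supC => x supx i; apply: le_trans supx.
by apply: ereal_sup_ubound; exists i.
Qed.

End limf_esup.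

Lemma limf_esup_limn_esup_eq0 (R : realType) (u : R -> nat -> \bar R) (K : R) :
  (forall e n, 0 <= u e n)%E -> 0 <= K ->
  (forall omega, 0 < omega -> \forall e \near 0^'+, \forall n \near \oo,
    (u e n <= (K * (omega + e))%:E)%E) ->
  limf_esup (fun e => limn_esup (u e)) 0^'+ = 0%E.
Proof.
move=> u0 K0 u_le; apply: limf_esup_eq0 => [e|delta delta0].
  by apply: limf_esup_ge0 => //; exact: filter_not_empty.
pose omega := delta / (2 * (K + 1)).
have omega0 : 0 < omega by rewrite divr_gt0// mulr_gt0// ltr_wpDl.
have K_omega : K * (omega + omega) <= delta.
  rewrite (_ : omega + omega = delta / (K + 1)).
    by rewrite mulrCA ger_pMr// ler_pdivrMr ?mul1r ?lerDl// ltr_wpDl.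
  by rewrite /omega; field; lra.
near=> e; apply: limf_esup_le.
have e_omega : e <= omega by near: e; exact: nbhs_right_le.
suff : \forall n \near \oo, (u e n <= (K * (omega + e))%:E)%E.
  apply: filterS => n /le_trans; apply; rewrite lee_fin (le_trans _ K_omega)//.
  by rewrite ler_wpM2l// lerD2l.
by near: e; exact: u_le.
Unshelve. all: by end_near. Qed.

Section uniform_continuity.
Variable R : realType.

Lemma compact_within_continuous_unif (U V : pseudoMetricType R) (K : set U)
    (f : U -> V) (e : R) :
  compact K -> {within K, continuous f} -> 0 < e ->
  exists2 d : R, 0 < d &
    forall x y, K x -> K y -> ball x d y -> ball (f x) e (f y).
Proof.
move=> cK cf e0; have : near_covering K by exact/compact_near_coveringP.
move=> /near_covering_withinP/(_ R 0^'+ (fun d x =>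
  forall y, K y -> ball x d y -> ball (f x) e (f y)))[].
  move=> x Kx.
  have e20 : 0 < e / 2 by rewrite divr_gt0.
  have := (subspace_continuousP K f).1 cf x Kx _ (nbhsx_ballx (f x) _ e20).
  rewrite /= /nbhs/= => /nbhs_ballP[a /= a0 aP].
  exists (ball x (a / 2), [set d | 0 < d < a / 2]) => /=.
    split; first by apply: nbhsx_ballx; rewrite divr_gt0.
    near=> d; apply/andP; split; near: d; first exact: nbhs_right_gt.
    by apply: nbhs_right_lt; rewrite divr_gt0.
  move=> [z d] /= [xz /andP[d0 da]] Kz y Ky zy; apply: (@ball_splitr _ _ (f x)).
    by apply: aP => //; apply: le_ball xz; rewrite ler_pdivrMr//; lra.
  by apply: aP => //; apply: ball_split xz _; exact: le_ball (ltW da) _ zy.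
move=> d /= d0 dP; exists (d / 2); first by rewrite divr_gt0.
move=> x y Kx Ky xy; apply: dP y Ky xy => //=; last by rewrite divr_gt0.
by rewrite distrC subr0 gtr0_norm ?divr_gt0// ltr_pdivrMr//; lra.
Unshelve. all: by end_near. Qed.

Lemma lipschitz_within_continuous (V W : normedModType R) (A : set V)
    (f : V -> W) : [lipschitz f x | x in A] -> {within A, continuous f}.
Proof.
move=> [k [_ kP]]; apply/subspace_continuousP => x Ax.
apply/cvgrPdist_lt => e e0; pose L := `|k| + 1.
have L0 : 0 < L by rewrite ltr_wpDl.
have kL : k < L by rewrite (le_lt_trans (ler_norm k))// ltrDl.
rewrite near_withinE; near=> y => Ay.
apply: le_lt_trans (kP _ kL (x, y) _) _ => //=.
rewrite -ltr_pdivlMl//; near: y; apply: cvgr_dist_lt => //.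
by rewrite mulrC divr_gt0.
Unshelve. all: by end_near. Qed.

Lemma compact_within_continuous_bounded (U : topologicalType)
    (V : normedModType R) (K : set U) (f : U -> V) :
  compact K -> {within K, continuous f} ->
  exists2 M : R, 0 <= M & forall x, K x -> `|f x| <= M.
Proof.
move=> cK cf; have /compact_bounded[M [_ MP]] := continuous_compact cf cK.
exists (`|M| + 1); first by rewrite addr_ge0.
have M_lt : M < `|M| + 1 by rewrite (le_lt_trans (ler_norm M))// ltrDl.
by move=> x Kx; apply: (MP _ M_lt); exists x.
Qed.

Lemma within_continuous_comp (U V W : topologicalType) (A : set U) (B : set V)
    (g : U -> V) (f : V -> W) : set_fun A B g -> continuous g ->
  {within B, continuous f} -> {within A, continuous (f \o g)}.
Proof.
move=> gAB cg cf; apply/subspace_continuousP => x Ax.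
have fgx := (subspace_continuousP B f).1 cf (g x) (gAB x Ax).
apply: cvg_comp fgx => S /(cg x); apply: (@filterS _ (nbhs x)) => y /= Sy Ay.
exact/Sy/gAB.
Qed.

End uniform_continuity.

(** * The coefficients [H_t] on [A_eps r e] *)

Section coefficients.
Variable R : realType.

Lemma A_epsP (r e : R) (z : R * R) : A_eps r e z <->
  [/\ `|z.1| < r \/ `|z.2| < r, e < `|z.1 - z.2| & `|z.1 - z.2| < e^-1].
Proof.
rewrite /A_eps /A_; split=> [[/= /not_andP h /andP[? ?]]|[h ? ?]].
  by split=> //; case: h => /negP; rewrite -ltNge; [left|right].
split; last exact/andP.
by move=> /= [rz1 rz2]; case: h; rewrite ltNge ?rz1 ?rz2.
Qed.

Lemma A_eps_norm_le (r e : R) (z : R * R) : A_eps r e z -> `|z| <= r + e^-1.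
Proof.
move=> /A_epsP[z_lt _ dist_lt]; rewrite prod_normE ge_max.
have := lerB_dist z.1 z.2; have := lerB_dist z.2 z.1.
rewrite (distrC z.2); have := normr_ge0 (z.1 - z.2).
by case: z_lt => ? ? ? ?; apply/andP; split; lra.
Qed.

Definition off_diagonal (b e : R) : set (R * R) :=
  [set z | `|z| <= b /\ e <= `|z.1 - z.2|].

Lemma A_eps_off_diagonal (r e : R) : A_eps r e `<=` off_diagonal (r + e^-1) e.
Proof.
by move=> z Az; split; [exact: A_eps_norm_le|case/A_epsP: Az => _ /ltW].
Qed.

Lemma compact_off_diagonal (b e : R) : compact (off_diagonal b e).
Proof.
have cB : compact (`[- b, b] `*` `[- b, b] : set (R * R)).
  by apply: compact_setX; exact: segment_compact.
apply: (subclosed_compact _ cB); last first.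
  move=> z [+ _]; rewrite prod_normE ge_max !ler_norml => /andP[z1 z2].
  by split; rewrite /= in_itv.
apply: closedI.
  apply: (preimage_closed (f := fun z : R * R => `|z|) _ (@closed_le R b)).
  by move=> z _; exact: norm_continuous.
apply: (preimage_closed (f := fun z : R * R => `|z.1 - z.2|) _
  (@closed_ge R e)).
by move=> z _; apply: cvg_norm; apply: cvgB; [exact: cvg_fst|exact: cvg_snd].
Qed.

Variables (gamma : R) (p G : R -> R -> R) (T : R).
Hypotheses (p_kernel : kernel_assumptions gamma p) (G_test : test_function G).

Lemma kernel_within_continuous (b e : R) : 0 < e ->
  {within off_diagonal b e, continuous (fun z => p z.1 z.2)}.
Proof.
move=> e0; apply: lipschitz_within_continuous.
apply: (kernel_K1 p_kernel); first exact: compact_off_diagonal.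
move=> z [_ ez] /=; apply: contraTneq ez => ->.
by rewrite subrr normr0 leNgt e0.
Qed.

Lemma H_within_continuous (b e : R) : 0 < e ->
  {within `[0, T] `*` off_diagonal b e,
    continuous (fun z : R * (R * R) => H_ p G z.1 z.2.1 z.2.2)}.
Proof.
move=> e0; have G_cont (pr : R * R -> R) : continuous pr ->
    {within `[0, T] `*` off_diagonal b e,
      continuous (fun z : R * (R * R) => G z.1 (pr z.2))}.
  move=> pr_cont; apply: (within_continuous_comp (g := fun z => (z.1, pr z.2))
    _ _ (test_continuous G_test)).
    by move=> z [] /=; rewrite in_itv/= => /andP[].
  move=> z; have z1_cvg : x.1 @[x --> z] --> z.1 by exact: cvg_fst.
  have z2_cvg : pr x.2 @[x --> z] --> pr z.2.
    by apply: (continuous_comp (f := snd)); [exact: cvg_snd|exact: pr_cont].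
  exact: (cvg_pair z1_cvg z2_cvg).
have fst_cont : continuous (@fst R R) by move=> z; exact: cvg_fst.
have snd_cont : continuous (@snd R R) by move=> z; exact: cvg_snd.
have Gu_cont := (subspace_continuousP _ _).1 (G_cont _ fst_cont).
have Gv_cont := (subspace_continuousP _ _).1 (G_cont _ snd_cont).
have p_cont : {within `[0, T] `*` off_diagonal b e,
    continuous (fun z : R * (R * R) => p z.2.1 z.2.2)}.
  apply: (within_continuous_comp (g := snd) _ _
    (kernel_within_continuous (b := b) e0)).
    by move=> z [].
  by move=> z; exact: cvg_snd.
apply/subspace_continuousP => z Cz.
apply: cvgM; first exact: (subspace_continuousP _ _).1 p_cont z Cz.
by apply: cvgB; [exact: Gv_cont|exact: Gu_cont].
Qed.

Variables (r e : R).
Hypothesis e_gt0 : 0 < e.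
Let K := `[0, T] `*` off_diagonal (r + e^-1) e.

Let K_compact : compact K.
Proof.
by apply: compact_setX; [exact: segment_compact|exact: compact_off_diagonal].
Qed.

Let H_cont :
  {within K, continuous (fun z : R * (R * R) => H_ p G z.1 z.2.1 z.2.2)}.
Proof. exact: H_within_continuous. Qed.

Let in_K (t : R) (z : R * R) : 0 <= t <= T -> A_eps r e z -> K (t, z).
Proof.
by move=> tT Az; split; [rewrite /= in_itv|exact: A_eps_off_diagonal].
Qed.

Lemma H_bounded_A_eps : exists2 M, 0 <= M &
  forall t, 0 <= t <= T -> forall z, A_eps r e z -> `|H_ p G t z.1 z.2| <= M.
Proof.
have [M M0 HM] := compact_within_continuous_bounded K_compact H_cont.
by exists M => // t tT z Az; exact: HM (in_K tT Az).
Qed.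

Lemma H_unif_continuous_A_eps (omega : R) : 0 < omega -> exists2 d, 0 < d &
  forall t, 0 <= t <= T ->
  forall z w, A_eps r e z -> A_eps r e w -> `|z - w| < d ->
  `|H_ p G t z.1 z.2 - H_ p G t w.1 w.2| <= omega.
Proof.
move=> omega0.
have [d d0 Hd] := compact_within_continuous_unif K_compact H_cont omega0.
exists d => // t tT z w Az Aw zw; apply: ltW.
apply: Hd (in_K tT Az) (in_K tT Aw) _.
by rewrite -ball_normE /ball_/= prod_normE/= subrr normr0 gt_max d0.
Qed.

End coefficients.

(** * Summation by parts for block averages *)

Section shifted_sums.

Lemma sumr_const_seq (S : pzSemiRingType) (I : Type) (s : seq I) (a : S) :
  \sum_(i <- s) a = (size s)%:R * a.
Proof. by rewrite big_const_seq count_predT iter_addr_0 -[a *+ _]mulr_natl. Qed.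

Lemma sum_shift (V : zmodType) (S : pzRingType) (s : seq V) (F g : V -> S)
    (k : V) :
  uniq s -> (forall w, F w != 0 -> w \in s /\ w + k \in s) ->
  \sum_(w <- s) F w * g (w + k) = \sum_(w <- s) F (w - k) * g w.
Proof.
move=> us Fs.
have sum_setT (f : V -> S) : (forall w, f w != 0 -> w \in s) ->
    \sum_(w <- s) f w = \sum_(w \in [set: V]) f w.
  move=> fs; rewrite (fsbigE s)//; last by move=> w _; apply: contraNeq => /fs.
  by apply: eq_bigl => w; rewrite in_setT.
have F_neq0 w a : F w * a != 0 -> F w != 0.
  by apply: contraNneq => ->; rewrite mul0r.
rewrite !sum_setT; last 2 first.
- by move=> w /F_neq0/Fs[_]; rewrite subrK.
- by move=> w /F_neq0/Fs[].
rewrite [RHS](reindex_fsbigT (fun w => w + k)).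
  by apply: eq_fsbigr => w _; rewrite addrK.
by exists (fun w => w - k) => w; rewrite ?addrK ?subrK.
Qed.

Lemma fsum_patch (V : choiceType) (S : pzRingType) (s : seq V) (A : set V)
    (F g : V -> S) : uniq s -> A `<=` [set` s] ->
  \sum_(w \in A) F w * g w = \sum_(w <- s) patch (fun=> 0) A F w * g w.
Proof.
move=> us As; rewrite fsbig_mkcond (fsbigE s)//=.
  apply: eq_big => [w|w _]; first by rewrite in_setT.
  by rewrite /patch; case: ifP => // _; rewrite mul0r.
move=> w _; apply: contraNeq; rewrite /patch; case: ifPn => [/set_mem/As//|_].
by rewrite eqxx.
Qed.

Variables (V : zmodType) (R : numFieldType).
Implicit Types (s shifts : seq V) (F phi : V -> R).

Definition shift_average shifts phi (w : V) : R :=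
  (size shifts)%:R^-1 * \sum_(k <- shifts) phi (w + k).

Lemma shift_average_cst shifts (a : R) (w : V) :
  (0 < size shifts)%N -> shift_average shifts (fun=> a) w = a.
Proof.
by move=> ?; rewrite /shift_average sumr_const_seq mulKf// pnatr_eq0 -lt0n.
Qed.

Lemma sum_sub_shift_average s shifts F phi :
  (0 < size shifts)%N -> uniq s ->
  (forall w k, F w != 0 -> k \in shifts -> w \in s /\ w + k \in s) ->
  \sum_(w <- s) F w * (phi w - shift_average shifts phi w) =
  (size shifts)%:R^-1 *
    \sum_(k <- shifts) \sum_(w <- s) (F w - F (w - k)) * phi w.
Proof.
move=> shifts0 us Fs.
under eq_bigr => w _ do rewrite -{1}(shift_average_cst (phi w) w shifts0)
  -mulrBr -sumrB mulrCA mulr_sumr.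
rewrite -mulr_sumr exchange_big/=; congr (_ * _).
apply: eq_big_seq => k kK; have Fsk w Fw := Fs w k Fw kK.
under eq_bigr do rewrite mulrBr; rewrite sumrB (sum_shift phi us Fsk) -sumrB.
by apply: eq_bigr => w _; rewrite mulrBl.
Qed.

Lemma norm_sum_sub_shift_average_le s shifts F phi (c : V -> R) :
  (0 < size shifts)%N -> uniq s ->
  (forall w k, F w != 0 -> k \in shifts -> w \in s /\ w + k \in s) ->
  (forall w k, k \in shifts -> `|F w - F (w - k)| <= c w) ->
  `|\sum_(w <- s) F w * (phi w - shift_average shifts phi w)| <=
  \sum_(w <- s) c w * `|phi w|.
Proof.
move=> shifts0 us Fs Fc; rewrite sum_sub_shift_average//.
rewrite normrM normfV normr_nat ler_pdivrMl ?ltr0n//.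
rewrite -sumr_const_seq; apply: le_trans (ler_norm_sum _ _ _) _.
rewrite big_seq [leRHS]big_seq.
apply: ler_sum => k kK; apply: le_trans (ler_norm_sum _ _ _) _.
by apply: ler_sum => w _; rewrite normrM ler_wpM2r// Fc.
Qed.

End shifted_sums.

Section integer_boxes.

Definition int_box (m : nat) : seq int :=
  [seq i%:Z - m%:Z | i <- iota 0 (2 * m + 1)].

Lemma int_box_uniq (m : nat) : uniq (int_box m).
Proof. by rewrite map_inj_uniq ?iota_uniq// => i j; lia. Qed.

Lemma size_int_box (m : nat) : size (int_box m) = (2 * m + 1)%N.
Proof. by rewrite size_map size_iota. Qed.

Lemma mem_int_box (m : nat) (x : int) : (x \in int_box m) = (`|x| <= m)%N.
Proof.
apply/mapP/idP => [[i]|xm]; first by rewrite mem_iota => ? ->; lia.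
by exists (absz (x + m%:Z)); rewrite ?mem_iota; lia.
Qed.

Definition int_square (m : nat) : seq (int * int) :=
  [seq (x, y) | x <- int_box m, y <- int_box m].

Lemma int_square_uniq (m : nat) : uniq (int_square m).
Proof.
by apply: allpairs_uniq (int_box_uniq m) (int_box_uniq m) _ => -[? ?] [? ?].
Qed.

Lemma size_int_square (m : nat) :
  size (int_square m) = ((2 * m + 1) * (2 * m + 1))%N.
Proof. by rewrite size_allpairs size_int_box. Qed.

Lemma mem_int_square (m : nat) (w : int * int) :
  (w \in int_square m) = ((`|w.1| <= m) && (`|w.2| <= m))%N.
Proof.
rewrite -!mem_int_box; apply/allpairsP/andP => [[w' [? ? ->//]]|[? ?]].
by exists w; split=> //; exact: surjective_pairing.
Qed.

Lemma int_squareD (l m : nat) (w k : int * int) : (l <= m)%N ->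
  w \in int_square (m - l) -> k \in int_square l -> w + k \in int_square m.
Proof.
case: w k => [x y] [x' y'] lm; rewrite !mem_int_square/=.
by move=> /andP[? ?] /andP[? ?]; apply/andP; split; lia.
Qed.

End integer_boxes.

Section jump_rates.
Variables (R : realType) (kappa l : nat).
Implicit Types (eta : configuration) (w : int * int).

Definition jump_rate eta w : R := (eta w.1)%:R * (kappa%:R - (eta w.2)%:R).

Definition averaged_jump_rate eta w : R :=
  block_avg R l eta w.1 * (kappa%:R - block_avg R l eta w.2).

Lemma block_avgE eta (x : int) :
  block_avg R l eta x =
  (2 * l + 1)%:R^-1 * \sum_(z <- int_box l) ((eta (x + z))%:R : R).
Proof.
rewrite /block_avg (_ : [set z : int | `|z| <= l%:Z] = [set` int_box l]).
  by rewrite -fsbig_seq// int_box_uniq.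
by apply/seteqP; split=> z /=; rewrite mem_int_box; lia.
Qed.

Lemma averaged_jump_rateE eta w :
  averaged_jump_rate eta w = shift_average (int_square l) (jump_rate eta) w.
Proof.
rewrite /averaged_jump_rate !block_avgE /shift_average size_int_square natrM.
rewrite invfM big_allpairs/=; set n : R := (2 * l + 1)%:R.
have -> : kappa%:R = n^-1 * \sum_(z <- int_box l) kappa%:R :> R.
  by rewrite sumr_const_seq size_int_box mulKf// pnatr_eq0 addn1.
rewrite -mulrBr -sumrB mulrACA mulr_suml; congr (_ * _).
by apply: eq_bigr => x _; rewrite mulr_sumr.
Qed.

Lemma norm_jump_rate_le eta w :
  `|jump_rate eta w| <=
  (kappa%:R + 1) * ((eta w.1)%:R ^+ 2 + (eta w.2)%:R ^+ 2).
Proof.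
rewrite /jump_rate; move: (eta w.1) (eta w.2) => a b.
rewrite normrM normr_nat.
apply: (@le_trans _ _ (a%:R * (kappa%:R + b%:R))).
  by rewrite ler_wpM2l// (le_trans (ler_normB _ _))// !normr_nat.
rewrite -!natrX -!natrD -natrM natr1 -natrM ler_nat.
rewrite mulnDr mulSn addnC leq_add//; first by nia.
by rewrite mulnC leq_mul2l; apply/orP; right; nia.
Qed.

Lemma norm_sum_averaged_jump_rate_le (m : nat) (A : set (int * int))
    (F c : int * int -> R) eta :
  (l <= m)%N -> A `<=` [set` int_square (m - l)] ->
  (forall w k, k \in int_square l -> `|(F \_ A) w - (F \_ A) (w - k)| <= c w) ->
  `|\sum_(w \in A) F w * (jump_rate eta w - averaged_jump_rate eta w)| <=
  (kappa%:R + 1) * \sum_(w <- int_square m)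
    c w * ((eta w.1)%:R ^+ 2 + (eta w.2)%:R ^+ 2).
Proof.
move=> lm Am Fc.
have square_le w : w \in int_square (m - l) -> w \in int_square m.
  by rewrite !mem_int_square; lia.
have F_supp w k : (F \_ A) w != 0 -> k \in int_square l ->
    w \in int_square m /\ w + k \in int_square m.
  rewrite patchE; case: ifPn => [/set_mem/Am/= wm _ kl|]; last by rewrite eqxx.
  by split; [exact: (square_le _ wm)|exact: (int_squareD lm wm kl)].
have A_sub : A `<=` [set` int_square m] by move=> w /Am; exact: square_le.
rewrite (fsum_patch _ _ (int_square_uniq m) A_sub).
under eq_bigr do rewrite averaged_jump_rateE.
have shifts0 : (0 < size (int_square l))%N by rewrite size_int_square addn1.
apply: (le_trans (norm_sum_sub_shift_average_le (jump_rate eta) shifts0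
  (int_square_uniq m) F_supp Fc)).
rewrite mulr_sumr; apply: ler_sum => w _; rewrite mulrCA.
apply: ler_wpM2l (norm_jump_rate_le eta w).
by apply: le_trans (Fc w 0 _); rewrite ?mem_int_square.
Qed.

End jump_rates.

(** * The boundary layer of [A_eps r e] *)

Section boundary_layer.
Variables (R : realType) (V : normedModType R).

Definition boundary_layer (A : set V) (h : R) : set V :=
  [set w | exists2 z, `|z| <= h & ~ (A (w - z) <-> A w)].

Lemma norm_patch_increment_le (A : set V) (f : V -> R) (M omega d h : R)
    (w z : V) :
  0 <= M -> 0 <= omega -> h < d -> `|z| <= h ->
  (forall v, A v -> `|f v| <= M) ->
  (forall v v', A v -> A v' -> `|v - v'| < d -> `|f v - f v'| <= omega) ->
  `|(f \_ A) w - (f \_ A) (w - z)| <= omega + M * \1_(boundary_layer A h) w.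
Proof.
move=> M0 omega0 hd zh fM f_omega.
have M_le : ~ (A (w - z) <-> A w) -> M <= omega + M * \1_(boundary_layer A h) w.
  move=> Awz; rewrite indicE mem_set; last by exists z.
  by rewrite mulr1 lerDr.
rewrite !patchE; case: ifPn => [/set_mem Aw|]; case: ifPn => [/set_mem Awz|].
- apply: (@le_trans _ _ omega); last by rewrite lerDl mulr_ge0.
  by apply: f_omega => //; rewrite subKr (le_lt_trans zh).
- move=> /negP; rewrite inE => Awz.
  by rewrite subr0 (le_trans (fM _ Aw))// M_le// => -[_ /(_ Aw)].
- move=> /negP; rewrite inE => Aw.
  by rewrite sub0r normrN (le_trans (fM _ Awz))// M_le// => -[/(_ Awz)].
- by rewrite subrr normr0 addr_ge0// mulr_ge0.
Qed.

End boundary_layer.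

Section annulus_boundary.
Variable R : realType.

Lemma lt_near_far (x y a h : R) : `|y - x| <= h -> h < `|x - a| ->
  (y < a) = (x < a).
Proof.
rewrite ler_distl => /andP[? ?]; rewrite ltr_normr => /orP[?|?];
  apply/idP/idP => ?; lra.
Qed.

Lemma gt_near_far (x y a h : R) : `|y - x| <= h -> h < `|x - a| ->
  (a < y) = (a < x).
Proof.
rewrite ler_distl => /andP[? ?]; rewrite ltr_normr => /orP[?|?];
  apply/idP/idP => ?; lra.
Qed.

Lemma dist_norm_subr_le (x z h : R) : `|z| <= h -> `| `|x - z| - `|x| | <= h.
Proof.
by move=> zh; rewrite (le_trans (ler_dist_dist _ _))// addrC addKr normrN.
Qed.

Lemma A_eps_stable (r e h : R) (w z : R * R) : `|z| <= h ->
  h < `| `|w.1| - r | -> h < `| `|w.2| - r | ->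
  h + h < `| `|w.1 - w.2| - e | -> h + h < `| `|w.1 - w.2| - e^-1 | ->
  A_eps r e (w - z) <-> A_eps r e w.
Proof.
rewrite prod_normE ge_max => /andP[z1 z2] far_fst far_snd far_e far_eV.
have dist12 : `| `|(w - z).1 - (w - z).2| - `|w.1 - w.2| | <= h + h.
  rewrite (_ : _ - (w - z).2 = w.1 - w.2 - (z.1 - z.2)) /=; last by ring.
  by apply: dist_norm_subr_le; rewrite (le_trans (ler_normB _ _))// lerD.
rewrite !A_epsP (lt_near_far (dist_norm_subr_le _ z1) far_fst).
rewrite (lt_near_far (dist_norm_subr_le _ z2) far_snd).
by rewrite (gt_near_far dist12 far_e) (lt_near_far dist12 far_eV).
Qed.

Lemma boundary_layer_A_eps (r e h : R) (w : R * R) :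
  boundary_layer (A_eps r e) h w ->
  [\/ `| `|w.1| - r | <= h, `| `|w.2| - r | <= h,
      `| `|w.1 - w.2| - e | <= h + h | `| `|w.1 - w.2| - e^-1 | <= h + h].
Proof.
move=> [z zh A_unstable].
have [|far_fst] := leP `| `|w.1| - r | h; first by constructor.
have [|far_snd] := leP `| `|w.2| - r | h; first by constructor.
have [|far_e] := leP `| `|w.1 - w.2| - e | (h + h); first by constructor.
have [|far_eV] := leP `| `|w.1 - w.2| - e^-1 | (h + h); first by constructor.
by case: A_unstable; exact: (A_eps_stable zh).
Qed.

End annulus_boundary.

Section lattice_count.
Variable R : realType.

Definition lattice_point (N : nat) (w : int * int) : R * R :=
  (w.1%:~R / N%:R, w.2%:~R / N%:R).

Lemma lattice_pointB (N : nat) (w k : int * int) :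
  lattice_point N (w - k) = lattice_point N w - lattice_point N k.
Proof. by rewrite /lattice_point /= !intrB !mulrBl. Qed.

Lemma norm_lattice_point_le (N l : nat) (k : int * int) : k \in int_square l ->
  `|lattice_point N k| <= l%:R / N%:R.
Proof.
rewrite mem_int_square prod_normE ge_max /= !normrM !normfV !normr_nat.
by move=> /andP[? ?]; apply/andP; split;
  rewrite ler_wpM2r// -intr_norm -natr_absz ler_nat.
Qed.

Lemma count_close_integers (s : seq int) (a h : R) : uniq s -> 0 <= h ->
  (count (fun x : int => `|x%:~R - a| <= h) s)%:R <= 2 * h + 1.
Proof.
move=> us h0; pose lo := Num.ceil (a - h).
pose close := [seq lo + i%:Z | i <- iota 0 (Num.truncn (2 * h)).+1].
apply: (@le_trans _ _ (size close)%:R); last first.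
  by rewrite size_map size_iota -natr1 lerD2r truncn_le; lra.
rewrite ler_nat -size_filter; apply: uniq_leq_size.
  by rewrite filter_uniq.
move=> x; rewrite mem_filter ler_distl => /andP[/andP[ax xa] _].
have lox : lo <= x by rewrite ceil_le_int.
apply/mapP; exists (absz (x - lo)); last by lia.
rewrite mem_iota /= add0n ltnS truncn_ge_nat; last by lra.
rewrite natr_absz ger0_norm; last by lia.
by rewrite intrB; have := ceil_ge (a - h); rewrite -/lo; lra.
Qed.

Lemma count_close_lattice (m N : nat) (a h : R) : (0 < N)%N -> 0 <= h ->
  (count (fun x : int => `|x%:~R / N%:R - a| <= h) (int_box m))%:R
  <= 2 * (h * N%:R) + 1.
Proof.
move=> N0 h0; have N_gt0 : 0 < N%:R :> R by rewrite ltr0n.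
rewrite (eq_count (a2 := fun x : int => `|x%:~R - a * N%:R| <= h * N%:R)).
  by apply: count_close_integers; [exact: int_box_uniq|exact: mulr_ge0].
move=> x /=; rewrite -[x%:~R in RHS](divfK (lt0r_neq0 N_gt0)) -mulrBl.
by rewrite normrM normr_nat ler_pM2r.
Qed.

Lemma count_close_norm_lattice (m N : nat) (a b h : R) :
  (0 < N)%N -> 1 <= h * N%:R ->
  (count (fun x : int => `| `|x%:~R / N%:R - b| - a | <= h) (int_box m))%:R
  <= 6 * (h * N%:R).
Proof.
move=> N0 hN; have h0 : 0 <= h.
  by rewrite -(pmulr_lge0 _ (_ : 0 < N%:R)) ?ltr0n// (le_trans _ hN).
pose close c := fun x : int => `|x%:~R / N%:R - c| <= h.
apply: (@le_trans _ _ (count (close (b + a)) (int_box m) +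
    count (close (b - a)) (int_box m))%:R); last first.
  have := count_close_lattice m (b + a) N0 h0.
  have := count_close_lattice m (b - a) N0 h0.
  by rewrite natrD /close; lra.
rewrite ler_nat -count_predUI (leq_trans _ (leq_addr _ _))//.
apply: sub_count => x; rewrite /close /= => near_x.
have [xb|xb] := leP 0 (x%:~R / N%:R - b).
  by rewrite opprD addrA; move: near_x; rewrite (ger0_norm xb) => ->.
apply/orP; right; rewrite -normrN.
move: near_x; rewrite (ltr0_norm xb).
by rewrite (_ : - (x%:~R / N%:R - (b - a)) = - (x%:~R / N%:R - b) - a)//; ring.
Qed.

Lemma natr_count (T : Type) (P : pred T) (s : seq T) :
  (count P s)%:R = \sum_(w <- s) (P w)%:R :> R.
Proof.
rewrite -sum1_count natr_sum big_mkcond/=.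
by apply: eq_bigr => w _; case: (P w).
Qed.

Lemma count_int_square_le (P : pred (int * int)) (m : nat) (k : R) :
  (forall x, (count (fun y => P (x, y)) (int_box m))%:R <= k) ->
  (count P (int_square m))%:R <= (2 * m + 1)%:R * k.
Proof.
move=> Pk; rewrite natr_count big_allpairs -[in leRHS](size_int_box m).
rewrite -sumr_const_seq; apply: ler_sum => x _.
by rewrite -(natr_count (fun y => P (x, y))).
Qed.

Lemma count_int_square_swap (P : pred (int * int)) (m : nat) :
  count P (int_square m) = count (fun w => P (w.2, w.1)) (int_square m).
Proof.
rewrite -!sum1_count [LHS]big_mkcond [RHS]big_mkcond/= !big_allpairs.
exact: exchange_big.
Qed.

Lemma sum_boundary_layer_A_eps (m N : nat) (r e h : R) :
  (0 < N)%N -> 1 <= h * N%:R ->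
  \sum_(w <- int_square m)
    \1_(boundary_layer (A_eps r e) h) (lattice_point N w)
  <= 36 * (2 * m + 1)%:R * (h * N%:R) :> R.
Proof.
move=> N0 hN.
pose near_fst (w : int * int) := `| `|w.1%:~R / N%:R| - r | <= h.
pose near_snd (w : int * int) := `| `|w.2%:~R / N%:R| - r | <= h.
pose near_dist a (w : int * int) :=
  `| `|w.1%:~R / N%:R - w.2%:~R / N%:R| - a | <= h + h.
have near_snd_count : (count near_snd (int_square m))%:R <=
    (2 * m + 1)%:R * (6 * (h * N%:R)).
  apply: count_int_square_le => x; rewrite /near_snd/=.
  have := count_close_norm_lattice m r 0 N0 hN.
  by under eq_count do rewrite subr0.
have near_fst_count : (count near_fst (int_square m))%:R <=
    (2 * m + 1)%:R * (6 * (h * N%:R)).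
  by rewrite count_int_square_swap.
have near_dist_count a : (count (near_dist a) (int_square m))%:R <=
    (2 * m + 1)%:R * (6 * ((h + h) * N%:R)).
  rewrite count_int_square_swap; apply: count_int_square_le => x.
  have hhN : 1 <= (h + h) * N%:R by lra.
  exact: (count_close_norm_lattice m a (x%:~R / N%:R) N0 hhN).
apply: (@le_trans _ _
    ((count near_fst (int_square m))%:R + (count near_snd (int_square m))%:R +
     (count (near_dist e) (int_square m))%:R +
     (count (near_dist e^-1) (int_square m))%:R)); last first.
  have := near_dist_count e; have := near_dist_count e^-1; lra.
rewrite !natr_count -!big_split/=; apply: ler_sum => w _.
rewrite indicE; case: (boolP (_ \in _)) => [/set_mem|_]; last first.
  by rewrite -!natrD.
move=> /boundary_layer_A_eps near_w; rewrite -!natrD ler1n !addn_gt0 !lt0b.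
by case: near_w; rewrite /near_fst /near_snd /near_dist => ->; rewrite ?orbT.
Qed.

Lemma mean_boundary_increment_le (m N : nat) (r e h M omega b : R) :
  (0 < N)%N -> 1 <= h * N%:R -> 1 <= b -> m%:R <= b * N%:R ->
  0 <= omega -> 0 <= M ->
  (N%:R ^+ 2)^-1 * \sum_(w <- int_square m)
    (omega + M * \1_(boundary_layer (A_eps r e) h) (lattice_point N w))
  <= (9 * b ^+ 2 + 108 * b * M) * (omega + h).
Proof.
move=> N0 hN b1 mb omega0 M0; have N_gt0 : 0 < N%:R :> R by rewrite ltr0n.
(* The square has at most [(3 b N) ^ 2] points, of which at most
   [36 (3 b N) (h N)] lie over the boundary layer. *)
have width : (2 * m + 1)%:R <= 3 * (b * N%:R) :> R.
  have : 1 <= b * N%:R by rewrite mulr_ege1// ler1n.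
  by rewrite natrD natrM; lra.
rewrite big_split/= -mulr_sumr sumr_const_seq size_int_square natrM.
rewrite mulrC ler_pdivrMr ?exprn_gt0//.
apply: (@le_trans _ _ (3 * (b * N%:R) * (3 * (b * N%:R)) * omega +
    M * (36 * (3 * (b * N%:R)) * (h * N%:R)))).
  rewrite lerD ?ler_wpM2r ?ler_wpM2l ?ler_pM//.
  apply: le_trans (sum_boundary_layer_A_eps _ _ _ N0 hN) _.
  by rewrite ler_wpM2r ?ler_wpM2l//; lra.
have h0 : 0 <= h by rewrite -(pmulr_lge0 _ N_gt0) (le_trans _ hN).
have b0 : 0 <= b by exact: le_trans b1.
rewrite -subr_ge0.
rewrite (_ : _ - _ = (9 * b ^+ 2 * h + 108 * b * M * omega) * N%:R ^+ 2).
  by rewrite mulr_ge0 ?exprn_ge0// addr_ge0// !mulr_ge0 ?exprn_ge0.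
by ring.
Qed.

End lattice_count.

(** * The expected replacement error *)

Section expected_error.
Variables (R : realType) (kappa : nat) (Q : probability (path_space R) R).
Variables (T C : R).
Hypothesis C_ge0 : 0 <= C.
Hypothesis second_moment_le : forall x : int,
  (\int[Q]_eta \int[lebesgue_measure]_(t in `[0%R, T]) sqr_occupation x (eta, t)
   <= C%:E)%E.

Let expected_sqr_occupation_pair_le (w : int * int) :
  (\int[Q]_eta \int[lebesgue_measure]_(t in `[0%R, T])
     (sqr_occupation w.1 (eta, t) + sqr_occupation w.2 (eta, t))
   <= (2 * C)%:E)%E.
Proof.
pose moment x (eta : path_space R) :=
  (\int[lebesgue_measure]_(t in `[0%R, T]) sqr_occupation x (eta, t))%E.
have moment0 x eta : (0 <= moment x eta)%E.
  by apply: integral_ge0 => t _; exact: sqr_occupation_ge0.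
have m_path x (eta : path_space R) :
    measurable_fun `[0, T] (fun t => sqr_occupation x (eta, t)).
  apply: measurable_funTS.
  exact: (measurable_fun_pair2 eta (measurable_sqr_occupation x)).
have m_moment x : measurable_fun setT (moment x).
  apply: measurable_fun_integral_section => //.
    exact: measurable_sqr_occupation.
  exact: sqr_occupation_ge0.
rewrite (eq_integral (fun eta => moment w.1 eta + moment w.2 eta)%E).
  rewrite ge0_integralD// mulr_natl mulr2n EFinD.
  by apply: leeD; exact: second_moment_le.
move=> eta _; rewrite ge0_integralD//; do ?exact: m_path;
  by move=> t _; exact: sqr_occupation_ge0.
Qed.

Lemma expected_integral_norm_le (s : seq (int * int)) (q : R)
    (c : int * int -> R) (S : path_space R -> R -> R) :
  0 <= q -> (forall w, 0 <= c w) ->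
  (forall eta t, 0 <= t <= T ->
    `|S eta t| <= \sum_(w <- s)
      c w * (((eta t w.1)%:R : R) ^+ 2 + ((eta t w.2)%:R : R) ^+ 2)) ->
  (\int[Q]_eta (q%:E * \int[lebesgue_measure]_(t in `[0%R, T]) `|S eta t|%:E)
    <= (2 * C * (q * \sum_(w <- s) c w))%:E)%E.
Proof.
move=> q0 c0 S_le.
apply: le_trans (ge0_le_iterated_integral_sum (s := s) (a := c)
  (g := fun w z => (sqr_occupation w.1 z + sqr_occupation w.2 z)%E)
  Q lebesgue_measure _ _ q0 c0 _ _ _) _ => //.
- by move=> w; apply: emeasurable_funD; exact: measurable_sqr_occupation.
- by move=> w z; rewrite adde_ge0// sqr_occupation_ge0.
- move=> eta t; rewrite /= in_itv/= => /S_le S_le_t.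
  by under eq_bigr do rewrite -EFinD -EFinM; rewrite sumEFin lee_fin.
rewrite !mulr_sumr -sumEFin; apply: lee_sum => w _.
rewrite [2 * C * _]mulrC [leRHS]EFinM.
apply: lee_wpmul2l (expected_sqr_occupation_pair_le w).
by rewrite lee_fin mulr_ge0.
Qed.

Variables (r e M omega d : R) (f : R -> R * R -> R).
Hypotheses (r_ge0 : 0 <= r) (e_gt0 : 0 < e).
Hypotheses (M_ge0 : 0 <= M) (omega_ge0 : 0 <= omega).
Hypothesis f_bounded : forall t, 0 <= t <= T ->
  forall w, A_eps r e w -> `|f t w| <= M.
Hypothesis f_modulus : forall t, 0 <= t <= T ->
  forall w w', A_eps r e w -> A_eps r e w' -> `|w - w'| < d ->
  `|f t w - f t w'| <= omega.

Let b := r + e^-1 + 1.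

Let b_ge1 : 1 <= b.
Proof. by rewrite /b lerDr addr_ge0// invr_ge0 ltW. Qed.

Variables (N : nat) (eps : R).
Hypotheses (N_gt0 : (0 < N)%N) (epsN : 1 <= eps * N%:R) (eps_le1 : eps <= 1).
Hypothesis eps_lt_d : eps < d.

Let l := Num.truncn (eps * N%:R).
Let m := Num.truncn (b * N%:R).

Let l_le_m : (l <= m)%N.
Proof.
by apply: le_truncn; rewrite ler_wpM2r// (le_trans eps_le1).
Qed.

Let scaled_A_eps_sub : scaled N (A_eps r e) `<=` [set` int_square (m - l)].
Proof.
have N_gt0' : 0 < N%:R :> R by rewrite ltr0n.
have coord_le (x : int) : `|x%:~R / N%:R : R| <= r + e^-1 -> (`|x| <= m - l)%N.
  rewrite normrM normfV normr_nat ler_pdivrMr// => xN.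
  rewrite leq_subRL// addnC truncn_ge_nat ?mulr_ge0 ?(le_trans _ b_ge1)//.
  rewrite natrD natr_absz intr_norm /b mulrDl mul1r lerD//.
  apply: le_trans (ler_piMl (ltW N_gt0') eps_le1).
  by rewrite truncn_le (le_trans _ epsN).
move=> w /A_eps_norm_le; rewrite prod_normE ge_max /= => /andP[w1 w2].
by rewrite mem_int_square !coord_le.
Qed.

Lemma expected_replacement_error_le :
  (\int[Q]_eta ((N%:R ^+ 2)^-1%:E * \int[lebesgue_measure]_(t in `[0%R, T])
     `|\sum_(w \in scaled N (A_eps r e)) f t (lattice_point R N w) *
        (jump_rate R kappa (eta t) w
         - averaged_jump_rate R kappa l (eta t) w)|%:E)
   <= (2 * C * (kappa%:R + 1) * (9 * b ^+ 2 + 108 * b * M) *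
       (omega + eps))%:E)%E.
Proof.
pose c w :=
  omega + M * \1_(boundary_layer (A_eps r e) eps) (lattice_point R N w).
have c0 w : 0 <= c w by rewrite addr_ge0// mulr_ge0.
have lN : l%:R / N%:R <= eps.
  by rewrite ler_pdivrMr ?ltr0n// truncn_le (le_trans _ epsN).
have kappa0 : 0 <= kappa%:R + 1 :> R by rewrite addr_ge0.
apply: le_trans (expected_integral_norm_le (s := int_square m)
  (c := fun w => (kappa%:R + 1) * c w) _ _ _) _.
- by rewrite invr_ge0 exprn_ge0.
- by move=> w; exact: mulr_ge0.
- move=> eta t tT; under [leRHS]eq_bigr do rewrite -mulrA.
  rewrite -mulr_sumr.
  apply: (norm_sum_averaged_jump_rate_le kappa (eta t) l_le_m scaled_A_eps_sub
    (F := fun w => f t (lattice_point R N w))) => w k kl.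
  have := norm_patch_increment_le (lattice_point R N w) M_ge0 omega_ge0 eps_lt_d
    (le_trans (norm_lattice_point_le R N kl) lN) (f_bounded tT) (f_modulus tT).
  by rewrite -lattice_pointB.
rewrite lee_fin -mulr_sumr [_^-1 * _]mulrCA -!(mulrA (2 * C)).
rewrite ler_wpM2l ?mulr_ge0// -mulrA ler_wpM2l//.
apply: mean_boundary_increment_le => //.
by rewrite truncn_le mulr_ge0// (le_trans _ b_ge1).
Qed.

End expected_error.

Theorem lemma3p10 (R : realType) (kappa : nat) (gamma : R) (p : R -> R -> R)
    (G : R -> R -> R) (T : R) (P : nat -> probability (path_space R) R)
    (hkappa : (0 < kappa)%N)
    (hp : kernel_assumptions gamma p)
    (hG : test_function G)
    (hT : 0 < T)
    (hGT : supp G `<=` [set z | z.1 < T])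
    (hP : forall T' : R, 0 < T' ->
      (limn_esup (fun N : nat =>
         ereal_sup [set \int[P N]_eta \int[lebesgue_measure]_(t in `[0%R, T'])
                          (((eta t x)%:R : R) ^+ 2)%:E | x in @setT int])
       < +oo)%E)
    (r eps' : R) (hr : 0 < r) (heps' : 0 < eps') :
  limf_esup (fun eps : R => limn_esup (fun N : nat =>
    (\int[P N]_eta ((N%:R ^+ 2)^-1%:E *
       \int[lebesgue_measure]_(t in `[0%R, T])
         `| \sum_(z \in scaled N (A_eps r eps'))
              H_ p G t (z.1%:~R / N%:R) (z.2%:~R / N%:R) *
              (let l := Num.truncn (eps * N%:R) in
               (eta t z.1)%:R * (kappa%:R - (eta t z.2)%:R)
               - block_avg R l (eta t) z.1
                 * (kappa%:R - block_avg R l (eta t) z.2)) |%:E))%E)) 0^'+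
  = 0%E.
Proof.
have [C C0 second_moment] := limf_esup_sup_lty_bounded _ (hP T hT).
have [M M0 H_bounded] := H_bounded_A_eps T hp hG r heps'.
pose b := r + eps'^-1 + 1.
pose K := 2 * C * (kappa%:R + 1) * (9 * b ^+ 2 + 108 * b * M).
apply: (limf_esup_limn_esup_eq0 (K := K)) => [eps N||omega omega0].
- apply: integral_ge0 => eta _.
  rewrite mule_ge0 ?lee_fin ?invr_ge0 ?exprn_ge0//.
  by apply: integral_ge0 => t _; rewrite lee_fin.
- have b0 : 0 <= b by rewrite !addr_ge0// ?invr_ge0 ltW.
  by rewrite /K !mulr_ge0 ?addr_ge0// ?mulr_ge0 ?exprn_ge0.
have [d d0 H_modulus] := H_unif_continuous_A_eps T hp hG r heps' omega0.
near=> eps; have eps0 : 0 < eps by near: eps; exact: nbhs_right_gt.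
near=> N; apply: (expected_replacement_error_le kappa C0 _ (ltW hr) heps' M0
  (ltW omega0) (f := fun t w => H_ p G t w.1 w.2) H_bounded H_modulus).
- by near: N; exact: second_moment.
- by near: N; exists 1%N.
- by rewrite mulrC -ler_pdivrMr// mul1r; near: N; exact: nbhs_infty_ger.
- by near: eps; exact: nbhs_right_le.
- by near: eps; exact: nbhs_right_lt.
Unshelve. all: by end_near. Qed.
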